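(* For any data matrix $Y\in\mathbb{R}^{n\times m}$, every critical point (i.e. every point where the gradient is zero) of the problem $$\min_{U\in\mathbb{R}^{n\times r},\;V\in\mathbb{R}^{m\times r}}\ \|UV^{\mathrm T}-Y\|_F^2$$ is either a global minimum or a strict saddle point, where the Hessian has at least one negative eigenvalue.
   Context: $n,m,r$ are positive integers with $r\le\min\{n,m\}$ ($U$ and $V$ are tall matrices). $\|\cdot\|_F$ is the Frobenius norm. The gradient and Hessian are those of the objective as a function of the pair $(U,V)\in\mathbb{R}^{n\times r}\times\mathbb{R}^{m\times r}$. A strict saddle is a critical point at which the Hessian has at least one negative eigenvalue. *)

(* Defs.v *)
From mathcomp Require Import all_boot all_order all_algebra.
From mathcomp Require Import all_classical all_reals all_analysis.

Set Implicit Arguments.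
Unset Strict Implicit.
Unset Printing Implicit Defensive.

Import Order.TTheory GRing.Theory Num.Theory.
Import numFieldNormedType.Exports.

Local Open Scope ring_scope.

(* The norm [`|A|] that MathComp-Analysis puts on matrices is the max norm, so
   the Frobenius norm has to be introduced separately. *)
Definition frobenius_norm (R : realType) (n m : nat) (A : 'M[R]_(n, m)) : R :=
  Num.sqrt (\sum_(i < n) \sum_(j < m) `|A i j| ^+ 2).

Section Calculus.
Variables (R : realType) (N : nat).
Implicit Types (f : 'rV[R]_N -> R) (x : 'rV[R]_N).

Definition partial (i : 'I_N) f : 'rV[R]_N -> R :=
  fun x => 'D_(delta_mx 0 i) f x.

Definition gradient f x : 'rV[R]_N := \row_i partial i f x.

Definition hessian f x : 'M[R]_N := \matrix_(i, j) partial i (partial j f) x.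

End Calculus.

(* The gradient and the Hessian of a function of a pair of matrices are taken
   in the coordinates given by the entries of U followed by the entries of V;
   these are the coordinates of the canonical orthonormal basis of
   R^(n x r) x R^(m x r). *)
Section PairOfMatrices.
Variables (R : realType) (n m r : nat).
Let pairs := ('M[R]_(n, r) * 'M[R]_(m, r))%type.
Implicit Types (f : pairs -> R) (p : pairs).

Definition pack p : 'rV[R]_(n * r + m * r) := row_mx (mxvec p.1) (mxvec p.2).

Definition unpack (x : 'rV[R]_(n * r + m * r)) : pairs :=
  (vec_mx (lsubmx x), vec_mx (rsubmx x)).

Lemma packK : cancel pack unpack.
Proof. by case=> U V; rewrite /unpack /pack row_mxKl row_mxKr !mxvecK. Qed.

Lemma unpackK : cancel unpack pack.
Proof. by move=> x; rewrite /unpack /pack !vec_mxK hsubmxK. Qed.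

Definition pair_gradient f p : 'rV[R]_(n * r + m * r) :=
  gradient (f \o unpack) (pack p).

Definition pair_hessian f p : 'M[R]_(n * r + m * r) :=
  hessian (f \o unpack) (pack p).

Definition critical_point f p : Prop := pair_gradient f p = 0.

Definition global_minimum f p : Prop := forall q : pairs, f p <= f q.

Definition strict_saddle f p : Prop :=
  critical_point f p /\
  exists2 lambda : R, lambda < 0 & eigenvalue (pair_hessian f p) lambda.

End PairOfMatrices.

Definition objective (R : realType) (n m r : nat) (Y : 'M[R]_(n, m))
    (p : 'M[R]_(n, r) * 'M[R]_(m, r)) : R :=
  frobenius_norm (p.1 *m p.2^T - Y) ^+ 2.

(* Main.v *)
Require Import Defs.
From mathcomp Require Import all_boot all_order all_algebra.
From mathcomp Require Import all_classical all_reals all_analysis.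
From mathcomp Require Import ring lra.

Set Implicit Arguments.
Unset Strict Implicit.
Unset Printing Implicit Defensive.

Import Order.TTheory GRing.Theory Num.Theory.
Import numFieldNormedType.Exports.

Local Open Scope ring_scope.

(* Let E = U V^T - Y be the residual at a critical point, so that E V = 0 and
   E^T U = 0, and suppose that the Hessian form
     (A, B) |-> 2 |A V^T + U B^T|^2 + 4 <E, A B^T>
   is nonnegative.  If U w = 0 with w <> 0, the directions (a w^T, b w^T) force
   E = 0.  Otherwise let s be the largest squared singular value of E,
   attained as |a E|^2 for a unit row vector a; the directions
   (a^T p, - (a E)^T q) show that the nonzero squared singular values of
   X = U V^T are at least s.  As X and E have
   orthogonal row spaces and orthogonal column spaces, X is a best rank r
   approximation of Y = X - E.  A negative value of the Hessian form gives a
   negative eigenvalue by minimising the Rayleigh quotient. *)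

(** * The Frobenius inner product and Gram matrices *)

Section FrobeniusInnerProduct.
Variable R : realFieldType.

Definition mxdot m n (A B : 'M[R]_(m, n)) : R := \tr (A *m B^T).

Lemma mxdotE m n (A B : 'M[R]_(m, n)) :
  mxdot A B = \sum_i \sum_j A i j * B i j.
Proof.
by apply: eq_bigr => i _; rewrite mxE; apply: eq_bigr => j _; rewrite mxE.
Qed.

Lemma mxdotC m n (A B : 'M[R]_(m, n)) : mxdot A B = mxdot B A.
Proof. by rewrite /mxdot -mxtrace_tr trmx_mul trmxK. Qed.

Lemma mxdotDl m n (A B C : 'M[R]_(m, n)) :
  mxdot (A + B) C = mxdot A C + mxdot B C.
Proof. by rewrite /mxdot mulmxDl mxtraceD. Qed.

Lemma mxdotDr m n (A B C : 'M[R]_(m, n)) :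
  mxdot C (A + B) = mxdot C A + mxdot C B.
Proof. by rewrite mxdotC mxdotDl !(mxdotC C). Qed.

Lemma mxdotZl m n a (A B : 'M[R]_(m, n)) : mxdot (a *: A) B = a * mxdot A B.
Proof. by rewrite /mxdot -scalemxAl mxtraceZ. Qed.

Lemma mxdotZr m n a (A B : 'M[R]_(m, n)) : mxdot A (a *: B) = a * mxdot A B.
Proof. by rewrite mxdotC mxdotZl mxdotC. Qed.

Lemma mxdotNl m n (A B : 'M[R]_(m, n)) : mxdot (- A) B = - mxdot A B.
Proof. by rewrite -scaleN1r mxdotZl mulN1r. Qed.

Lemma mxdotNr m n (A B : 'M[R]_(m, n)) : mxdot A (- B) = - mxdot A B.
Proof. by rewrite mxdotC mxdotNl mxdotC. Qed.

Lemma mxdot0l m n (A : 'M[R]_(m, n)) : mxdot 0 A = 0.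
Proof. by rewrite /mxdot mul0mx mxtrace0. Qed.

Lemma mxdot0r m n (A : 'M[R]_(m, n)) : mxdot A 0 = 0.
Proof. by rewrite mxdotC mxdot0l. Qed.

Lemma mxdot_trmx m n (A B : 'M[R]_(m, n)) : mxdot A^T B^T = mxdot A B.
Proof. by rewrite /mxdot trmxK mxtrace_mulC -/(mxdot B A) mxdotC. Qed.

Lemma mxdot_mulmxl m n p (A : 'M[R]_(m, n)) (B : 'M[R]_(n, p)) C :
  mxdot (A *m B) C = mxdot A (C *m B^T).
Proof. by rewrite /mxdot trmx_mul trmxK mulmxA. Qed.

Lemma mxdot_mulmxr m n p (A : 'M[R]_(m, n)) (B : 'M[R]_(n, p)) C :
  mxdot (A *m B) C = mxdot B (A^T *m C).
Proof.
by rewrite -mxdot_trmx trmx_mul mxdot_mulmxl trmxK -mxdot_trmx trmxK trmx_mul trmxK.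
Qed.

Lemma mxdot_ge0 m n (A : 'M[R]_(m, n)) : 0 <= mxdot A A.
Proof.
by rewrite mxdotE; do 2![apply: sumr_ge0 => ? _]; rewrite -expr2 sqr_ge0.
Qed.

Lemma mxdot_eq0 m n (A : 'M[R]_(m, n)) : mxdot A A = 0 -> A = 0.
Proof.
rewrite mxdotE => /eqP; rewrite psumr_eq0 => [/allP A0|i _]; last first.
  by apply: sumr_ge0 => j _; rewrite -expr2 sqr_ge0.
apply/matrixP => i j; rewrite mxE.
have /implyP/(_ isT) := A0 i (mem_index_enum _).
rewrite psumr_eq0 => [/allP|k _]; last by rewrite -expr2 sqr_ge0.
move=> /(_ j (mem_index_enum _))/implyP/(_ isT).
by rewrite -expr2 sqrf_eq0 => /eqP.
Qed.

Lemma mxdot_row m n (A : 'M[R]_(m, n)) :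
  mxdot A A = \sum_i mxdot (row i A) (row i A).
Proof.
rewrite mxdotE; apply: eq_bigr => i _.
by rewrite mxdotE big_ord1; apply: eq_bigr => j _; rewrite !mxE.
Qed.

Lemma mxdot_rV_mul n (x y : 'rV[R]_n) : x *m y^T = (mxdot x y)%:M.
Proof.
by rewrite /mxdot [in LHS](mx11_scalar (x *m y^T)) /mxtrace big_ord1.
Qed.

Lemma mxdot_outer k l (u u' : 'rV[R]_k) (v v' : 'rV[R]_l) :
  mxdot (u^T *m v) (u'^T *m v') = mxdot u u' * mxdot v v'.
Proof.
rewrite mxdot_mulmxl -mulmxA mxdot_rV_mul mul_mx_scalar mxdotZr mxdot_trmx.
by rewrite mulrC (mxdotC v').
Qed.

(** A row [x] killed by [A^T *m A] satisfies [|x A^T|^2 = 0], and full column rank makes [A^T] row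
    free, so [x = 0]. *)
Lemma gram_unitmx m n (A : 'M[R]_(m, n)) :
  \rank A = n -> A^T *m A \in unitmx.
Proof.
move=> rA; rewrite -row_free_unit -kermx_eq0; apply/eqP/row_matrixP => i.
set K := kermx _; rewrite row0.
have xK : row i K *m (A^T *m A) = 0 by rewrite -row_mul mulmx_ker row0.
have /mxdot_eq0 xA0 : mxdot (row i K *m A^T) (row i K *m A^T) = 0.
  by rewrite mxdot_mulmxl trmxK -mulmxA xK mxdot0r.
have : row_free A^T by rewrite /row_free mxrank_tr rA.
by move=> /row_free_inj; apply; rewrite xA0 mul0mx.
Qed.

End FrobeniusInnerProduct.

(** * Minima of Rayleigh quotients and negative eigenvalues *)

Section Rayleigh.
Local Open Scope classical_set_scope.
Local Open Scope ring_scope.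
Variable R : realType.

Lemma continuous_sum (T : topologicalType) (I : Type) (r : seq I)
    (f : I -> T -> R) :
  (forall i, continuous (f i)) -> continuous (fun x => \sum_(i <- r) f i x).
Proof.
move=> cf; elim: r => [|i r IHr].
  rewrite (_ : (fun _ => _) = cst 0); first exact: cst_continuous.
  by apply/funext => x; rewrite big_nil.
rewrite (_ : (fun _ => _) = f i \+ (fun x => \sum_(j <- r) f j x)).
  by move=> x; apply: continuousD; [exact: cf | exact: IHr].
by apply/funext => x; rewrite big_cons.
Qed.

Lemma mxdot_mul_continuous n (H : 'M[R]_n) :
  continuous (fun y : 'rV[R]_n => mxdot (y *m H) y).
Proof.
rewrite (_ : (fun _ => _) =
    fun y : 'rV[R]_n => \sum_j (\sum_k y 0 k * H k j) * y 0 j); last first.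
  apply/funext => z; rewrite mxdotE big_ord1.
  by apply: eq_bigr => j _; rewrite mxE.
apply: continuous_sum => j y; apply: continuousM; last exact: coord_continuous.
apply: continuous_sum => k {}y; apply: continuousM; first exact: coord_continuous.
exact: cst_continuous.
Qed.

(** Each squared entry is at most [mxdot y y = 1], which bounds the max norm; closedness comes from
    continuity of the quadratic form of the identity matrix. *)
Lemma unit_sphere_compact n : compact [set y : 'rV[R]_n | mxdot y y = 1].
Proof.
apply: bounded_closed_compact.
  exists 1; split => // M M1 y /= y1; rewrite [leLHS]/Num.norm/= mx_normrE.
  apply/bigmax_leP; split=> [|[i j] _ /=]; first by rewrite ltW// (lt_trans _ M1).
  rewrite (le_trans _ (ltW M1))// -(@expr_le1 _ 2)// -normrX ger0_norm ?sqr_ge0//.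
  rewrite -y1 mxdotE big_ord1 (ord1 i) (bigD1 j)//= expr2 lerDl.
  by apply: sumr_ge0 => k _; rewrite -expr2 sqr_ge0.
rewrite (_ : mkset _ = (fun y : 'rV[R]_n => mxdot (y *m 1%:M) y) @^-1` [set 1]).
  by apply: preimage_closed => [y _|]; [exact: mxdot_mul_continuous | exact: closed_eq].
by apply/seteqP; split => y /=; rewrite mulmx1.
Qed.

(** The form attains its minimum on the compact sphere, nonempty since [0 < n]; normalising [y]
    extends the bound to all vectors by homogeneity. *)
Lemma rayleigh_min n (H : 'M[R]_n) : (0 < n)%N ->
  exists2 u : 'rV[R]_n, mxdot u u = 1 &
    forall y : 'rV[R]_n, mxdot (u *m H) u * mxdot y y <= mxdot (y *m H) y.
Proof.
case: n H => // n H _.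
have [||u] := @EVT_min_rV _ _ (fun y : 'rV[R]_n.+1 => mxdot (y *m H) y) _ _
  (@unit_sphere_compact n.+1).
- exists (delta_mx 0 0) => /=.
  by rewrite /mxdot trmx_delta mul_delta_mx /mxtrace big_ord1 mxE.
- exact/continuous_subspaceT/mxdot_mul_continuous.
rewrite inE => /= u1 umin; exists u => // y.
have [/mxdot_eq0 ->|y0] := eqVneq (mxdot y y) 0.
  by rewrite mul0mx !mxdot0r mulr0.
have y_gt0 : 0 < mxdot y y by rewrite lt_neqAle eq_sym y0 mxdot_ge0.
pose c := (Num.sqrt (mxdot y y))^-1.
have c2 : c * c = (mxdot y y)^-1 by rewrite -invfM -expr2 sqr_sqrtr// ltW.
rewrite -ler_pdivlMr// mulrC -c2 -mulrA -mxdotZr -mxdotZl scalemxAl umin//.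
by rewrite inE/= mxdotZl mxdotZr mulrA c2 mulVf.
Qed.

(** The minimum of the Rayleigh quotient is negative because of [v], and by symmetry of [H] its
    minimiser is an eigenvector for that value. *)
Lemma negative_eigenvalue n (H : 'M[R]_n) (v : 'rV[R]_n) :
  H^T = H -> mxdot (v *m H) v < 0 ->
  exists2 lambda : R, lambda < 0 & eigenvalue H lambda.
Proof.
move=> symH vHv.
have n_gt0 : (0 < n)%N.
  by case: n H v symH vHv => // H v _; rewrite (thinmx0 v) mul0mx mxdot0l ltxx.
have [u u1 umin] := rayleigh_min H n_gt0.
pose l := mxdot (u *m H) u.
exists l.
  rewrite ltNge; apply/negP => l0.
  by have := le_lt_trans (umin v) vHv; rewrite ltNge mulr_ge0 ?mxdot_ge0.
apply/eigenvalueP; exists u; last first.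
  by apply: contra_eq_neq u1 => ->; rewrite mxdot0l eq_sym oner_eq0.
(* First-order condition at the minimiser [u], tested in the direction of the
   residual [w]. *)
pose w := u *m H - l *: u.
suff /mxdot_eq0/eqP : mxdot w w = 0 by rewrite subr_eq0 => /eqP.
have uw : mxdot u w = 0.
  by rewrite /w mxdotDr mxdotNr mxdotZr u1 mxdotC -/l mulr1 subrr.
have uHw : mxdot (u *m H) w = mxdot w w.
  by rewrite {2}/w [in RHS]mxdotDl mxdotNl mxdotZl uw mulr0 subr0.
have wHu : mxdot (w *m H) u = mxdot w w.
  by rewrite mxdot_mulmxl symH mxdotC uHw.
clearbody w.
have quad t :
    0 <= 2 * t * mxdot w w + t ^+ 2 * (mxdot (w *m H) w - l * mxdot w w).
  have := umin (u + t *: w); rewrite -/l mulmxDl -scalemxAl.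
  rewrite !(mxdotDl, mxdotDr) !(mxdotZl, mxdotZr) u1 uw (mxdotC w u) uw uHw wHu -/l.
  lra.
set a := mxdot w w in quad *; set b := _ - _ in quad.
have a_ge0 : 0 <= a by exact: mxdot_ge0.
apply/eqP; rewrite eq_le a_ge0 andbT.
(* With [c = 1 + |b|], the quadratic at [t = - a / c] equals [(a^2 / c^2) (b - 2 c)], which is
   negative if [a > 0], since [b <= c]. *)
have := quad (- a / (1 + `|b|)).
have b1 : 0 < 1 + `|b| by rewrite ltr_pwDl.
set c := (1 + `|b|) in b1 *.
have bc : b <= c by rewrite /c; have := ler_norm b; lra.
move=> quad_c; rewrite leNgt; apply/negP => a_gt0.
move: quad_c; apply/negP; rewrite -ltNge.
rewrite (_ : _ + _ = (a ^+ 2 / c ^+ 2) * (b - 2 * c));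
  last by field; rewrite gt_eqF.
rewrite pmulr_rlt0 ?divr_gt0 ?exprn_gt0//; lra.
Qed.

End Rayleigh.

(** * Derivatives of functions that are polynomial along a line *)

Section Derivatives.
Local Open Scope classical_set_scope.
Local Open Scope ring_scope.
Variable R : realType.

(** The difference quotient equals [p.[h]] for [h != 0], so the limit is the constant coefficient;
    no differentiability has to be established first. *)
Lemma derive_along_line N (f : 'rV[R]_N -> R) x v (p : {poly R}) :
  (forall h, f (h *: v + x) = f x + h * p.[h]) -> 'D_v f x = p.[0].
Proof.
move=> fE; rewrite /derive; apply: cvg_lim => //.
apply: (@cvg_trans _ ((fun h : R => p.[h]) @ 0^')).
  apply: near_eq_cvg; near=> h => /=.
  rewrite fE addrC addKr /GRing.scale/= mulKf//.
  by near: h; exact: nbhs_dnbhs_neq.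
by apply: cvg_within_filter; exact: continuous_horner.
Unshelve. all: by end_near. Qed.

End Derivatives.

(** * Linear forms in coordinates *)

Section LinearForms.
Variable R : comNzRingType.

Lemma linear_form_row N (f : 'rV[R]_N -> R) (x : 'rV[R]_N) :
  (forall a y z, f (a *: y + z) = a * f y + f z) ->
  f x = \sum_i x 0 i * f (delta_mx 0 i).
Proof.
move=> f_lin.
have f0 : f 0 = 0.
  by apply: (addrI (f 0)); rewrite addr0 -{1}[f 0]mul1r -f_lin scaler0 addr0.
rewrite {1}[x]row_sum_delta; elim/big_rec2: _ => [//|i y z _ <-].
by rewrite f_lin.
Qed.

End LinearForms.

(** * Gradient and Hessian of the factorisation objective *)

Section ObjectiveDerivatives.
Variables (R : realType) (n m r : nat) (Y : 'M[R]_(n, m)).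
Let pairs := ('M[R]_(n, r) * 'M[R]_(m, r))%type.
Implicit Types p q : pairs.

Definition residual (p : pairs) : 'M[R]_(n, m) := p.1 *m p.2^T - Y.

Lemma objectiveE (p : pairs) : objective Y p = mxdot (residual p) (residual p).
Proof.
rewrite /objective /frobenius_norm sqr_sqrtr; last first.
  by do 2![apply: sumr_ge0 => ? _]; exact: sqr_ge0.
rewrite mxdotE; apply: eq_bigr => i _; apply: eq_bigr => j _.
by rewrite real_normK ?num_real.
Qed.

Lemma unpack_linear a (x y : 'rV[R]_(n * r + m * r)) :
  unpack (a *: x + y) =
  (a *: (unpack x).1 + (unpack y).1, a *: (unpack x).2 + (unpack y).2).
Proof. by rewrite /unpack !linearP. Qed.

(* The polar form of the quadratic map [(U, V) |-> U V^T]. *)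
Definition cross (p q : pairs) : 'M[R]_(n, m) :=
  p.1 *m q.2^T + q.1 *m p.2^T.

Lemma crossC p q : cross p q = cross q p.
Proof. by rewrite /cross addrC. Qed.

Definition gradient_form p q : R := 2 * mxdot (residual p) (cross p q).

(** The polarised form: [cross q q] is twice [q.1 *m q.2^T], so the diagonal carries the coefficient
    4 on the residual term. *)
Definition hessian_form p q q' : R :=
  2 * (mxdot (cross p q) (cross p q') + mxdot (residual p) (cross q q')).

Lemma residual_line h (p q : pairs) :
  residual (h *: q.1 + p.1, h *: q.2 + p.2) =
  residual p + h *: cross p q + (h * h) *: (q.1 *m q.2^T).
Proof.
rewrite /residual /cross/= !linearD/= !linearZ/= !mulmxDl ?mulmxDr.
rewrite -?scalemxAl -?scalemxAr.
by apply/matrixP => i j; rewrite !mxE; ring.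
Qed.

Lemma derive_objective (x v : 'rV[R]_(n * r + m * r)) :
  'D_v (objective Y \o @unpack R n m r) x = gradient_form (unpack x) (unpack v).
Proof.
set p := unpack x; set q := unpack v.
pose L := cross p q; pose M := q.1 *m q.2^T.
(* The increment of [|E + h L + h^2 M|^2], with [E] the residual, divided by [h]. *)
pose P : {poly R} := (2 * mxdot (residual p) L)%:P +
  'X * ((mxdot L L + 2 * mxdot (residual p) M)%:P +
        'X * ((2 * mxdot L M)%:P + 'X * (mxdot M M)%:P)).
rewrite (@derive_along_line _ _ _ _ _ P) => [|h].
  by rewrite /P !hornerE.
rewrite /comp unpack_linear -/p -/q !objectiveE/= -!/(residual _).
rewrite (residual_line h p q).
rewrite -/L -/M {}/P !hornerE.
move: (residual p) => E; clearbody L M.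
rewrite !(mxdotDl, mxdotDr, mxdotZl, mxdotZr).
rewrite (mxdotC L E) (mxdotC M E) (mxdotC M L).
ring.
Qed.

Lemma derive_gradient (x v w : 'rV[R]_(n * r + m * r)) :
  'D_w (fun y => gradient_form (unpack y) (unpack v)) x =
  hessian_form (unpack x) (unpack w) (unpack v).
Proof.
set p := unpack x; set q := unpack w; set q' := unpack v.
pose M := q.1 *m q.2^T; pose L := cross p q; pose L' := cross p q'.
pose K := cross q q'.
(* The increment of [2 <E + h L + h^2 M, L' + h K>], with [E] the residual, divided by [h]. *)
pose P : {poly R} := (2 * (mxdot L L' + mxdot (residual p) K))%:P +
  'X * ((2 * (mxdot L K + mxdot M L'))%:P + 'X * (2 * mxdot M K)%:P).
rewrite (@derive_along_line _ _ _ _ _ P) => [|h]; first by rewrite /P !hornerE.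
rewrite unpack_linear -/p -/q -/q' /gradient_form.
rewrite (residual_line h p q).
have -> : cross (h *: q.1 + p.1, h *: q.2 + p.2) q' = L' + h *: K.
  rewrite /L' /K /cross/= !linearD/= !linearZ/= !mulmxDl ?mulmxDr.
  rewrite -?scalemxAl -?scalemxAr.
  by apply/matrixP => i j; rewrite !mxE; ring.
rewrite {}/P !hornerE /= -/L -/M -/L'.
move: (residual p) => E; clearbody L L' M K.
rewrite !(mxdotDl, mxdotDr, mxdotZl, mxdotZr).
ring.
Qed.

Lemma gradient_formZD p a (q q' : pairs) :
  gradient_form p (a *: q.1 + q'.1, a *: q.2 + q'.2) =
  a * gradient_form p q + gradient_form p q'.
Proof.
rewrite /gradient_form; move: (residual p) => E.
rewrite /cross/= !linearD/= !linearZ/= !mulmxDl ?mulmxDr.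
rewrite -?scalemxAl -?scalemxAr !(mxdotDl, mxdotDr, mxdotZl, mxdotZr).
ring.
Qed.

Lemma hessian_formC p q q' : hessian_form p q q' = hessian_form p q' q.
Proof. by rewrite /hessian_form mxdotC (crossC q). Qed.

Lemma hessian_formZD p q a (q' q'' : pairs) :
  hessian_form p q (a *: q'.1 + q''.1, a *: q'.2 + q''.2) =
  a * hessian_form p q q' + hessian_form p q q''.
Proof.
rewrite /hessian_form; move: (residual p) => E.
rewrite /cross/= !linearD/= !linearZ/= !mulmxDl ?mulmxDr.
rewrite -?scalemxAl -?scalemxAr !(mxdotDl, mxdotDr, mxdotZl, mxdotZr).
ring.
Qed.

(** The partial derivatives vanish, and linearity in [q] carries this to every direction. *)
Lemma gradient_form_critical p q :
  critical_point (objective Y) p -> gradient_form p q = 0.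
Proof.
move=> /rowP grad0; rewrite -(packK q).
have lin a x y : gradient_form p (unpack (a *: x + y)) =
    a * gradient_form p (unpack x) + gradient_form p (unpack y).
  by rewrite unpack_linear gradient_formZD.
rewrite [LHS](linear_form_row _ lin) big1// => i _; have := grad0 i.
by rewrite !mxE /partial derive_objective packK => ->; rewrite mulr0.
Qed.

Lemma pair_hessianE p i j : pair_hessian (objective Y) p i j =
  hessian_form p (unpack (delta_mx 0 i)) (unpack (delta_mx 0 j)).
Proof.
rewrite mxE /partial (_ : (fun _ => _) =
    fun y => gradient_form (unpack y) (unpack (delta_mx 0 j))).
  by rewrite derive_gradient packK.
by apply/funext => y; rewrite derive_objective.
Qed.

Lemma pair_hessian_tr p :
  (pair_hessian (objective Y) p)^T = pair_hessian (objective Y) p.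
Proof.
by apply/matrixP => i j; rewrite mxE !pair_hessianE hessian_formC.
Qed.

(** The matrix entries are the values of the bilinear form on coordinate directions. This turns a
    negative value of the form into a spectral statement. *)
Lemma pair_hessian_quadratic p q :
  mxdot (pack q *m pair_hessian (objective Y) p) (pack q) = hessian_form p q q.
Proof.
have lin2 q1 a x y : hessian_form p q1 (unpack (a *: x + y)) =
    a * hessian_form p q1 (unpack x) + hessian_form p q1 (unpack y).
  by rewrite unpack_linear hessian_formZD.
rewrite -[in RHS](packK q) [RHS](linear_form_row _ (lin2 _)).
rewrite mxdotE big_ord1; apply: eq_bigr => j _; rewrite mulrC; congr (_ * _).
rewrite hessian_formC [RHS](linear_form_row _ (lin2 _)) mxE.
by apply: eq_bigr => i _; rewrite pair_hessianE hessian_formC.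
Qed.

Lemma strict_saddle_hessian p q : critical_point (objective Y) p ->
  hessian_form p q q < 0 -> strict_saddle (objective Y) p.
Proof.
move=> pcrit; rewrite -pair_hessian_quadratic => neg; split=> //.
exact: negative_eigenvalue (pair_hessian_tr p) neg.
Qed.

End ObjectiveDerivatives.

(** * Orthogonal projections and best low-rank approximation *)

Section OrthogonalProjections.
Variable R : realFieldType.

(** The orthogonal projection onto the column space of [C], provided [C] has full column rank. *)
Definition colproj n k (C : 'M[R]_(n, k)) : 'M[R]_n :=
  C *m invmx (C^T *m C) *m C^T.

Lemma colproj_tr n k (C : 'M[R]_(n, k)) : (colproj C)^T = colproj C.
Proof. by rewrite /colproj !trmx_mul trmx_inv trmx_mul !trmxK mulmxA. Qed.

Lemma colproj_mul n k (C : 'M[R]_(n, k)) :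
  \rank C = k -> colproj C *m C = C.
Proof. by move=> rC; rewrite /colproj -!mulmxA mulVmx ?mulmx1 ?gram_unitmx. Qed.

Lemma colproj_idem n k (C : 'M[R]_(n, k)) :
  \rank C = k -> colproj C *m colproj C = colproj C.
Proof. by move=> rC; rewrite {1}/colproj !mulmxA colproj_mul. Qed.

Lemma mxtrace_colproj n k (C : 'M[R]_(n, k)) :
  \rank C = k -> \tr (colproj C) = k%:R.
Proof.
by move=> rC; rewrite mxtrace_mulC mulmxA mulmxV ?gram_unitmx// mxtrace1.
Qed.

Lemma mxdot_proj n (P : 'M[R]_n) : P^T = P -> P *m P = P -> mxdot P P = \tr P.
Proof. by move=> symP PP; rewrite /mxdot symP PP. Qed.

Lemma pythagoras n m (P : 'M[R]_n) (A : 'M[R]_(n, m)) :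
  P^T = P -> P *m P = P ->
  mxdot A A = mxdot (P *m A) (P *m A) + mxdot (A - P *m A) (A - P *m A).
Proof.
move=> symP PP; rewrite !(mxdotDl, mxdotDr) !(mxdotNl, mxdotNr).
rewrite (mxdotC A (P *m A)).
suff -> : mxdot (P *m A) (P *m A) = mxdot (P *m A) A by ring.
by rewrite mxdotC mxdot_mulmxr symP mulmxA PP mxdotC.
Qed.

Lemma mxdot_le_mulmx n k l s (X : 'M[R]_(n, k)) (Z : 'M[R]_(n, l)) :
  (forall x : 'rV[R]_n, s * mxdot (x *m X) (x *m X) <= mxdot (x *m Z) (x *m Z)) ->
  forall p (A : 'M[R]_(p, n)),
    s * mxdot (A *m X) (A *m X) <= mxdot (A *m Z) (A *m Z).
Proof.
move=> XZ p A; rewrite (mxdot_row (A *m X)) (mxdot_row (A *m Z)) mulr_sumr.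
by apply: ler_sum => i _; rewrite !row_mul.
Qed.

(* [X] is the part of [X + F] carrying the singular values at least [sqrt s],
   and [F] the part carrying those at most [sqrt s]. *)
Lemma best_approximation n m r s (X F Z : 'M[R]_(n, m)) (P Q : 'M[R]_n) :
  0 <= s ->
  Q^T = Q -> Q *m Q = Q -> \tr Q = r%:R ->
  P^T = P -> P *m P = P -> \tr P <= r%:R ->
  Q *m F = 0 -> X *m F^T = 0 -> P *m Z = Z ->
  (forall x : 'rV[R]_n, s * mxdot (x *m Q) (x *m Q) <= mxdot (x *m X) (x *m X)) ->
  (forall x : 'rV[R]_n, mxdot (x *m F) (x *m F) <= s * mxdot x x) ->
  mxdot F F <= mxdot (Z - (X + F)) (Z - (X + F)).
Proof.
move=> s0 symQ QQ trQ symP PP trP QF XF PZ leX leF.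
have XF0 : mxdot X F = 0 by rewrite /mxdot XF mxtrace0.
have PXF0 : mxdot (P *m X) (P *m F) = 0.
  by rewrite /mxdot trmx_mul mulmxA -(mulmxA P X) XF mulmx0 mul0mx mxtrace0.
have leX' := mxdot_le_mulmx leX (1%:M - P).
have leF' : mxdot (P *m F) (P *m F) <= s * mxdot (P - P *m Q) (P - P *m Q).
  (* As [Q] kills [F], only the part of [P] orthogonal to [Q] acts on [F]. *)
  have -> : P *m F = (P - P *m Q) *m F.
    by rewrite mulmxBl -mulmxA QF mulmx0 subr0.
  rewrite (mxdot_row (_ *m F)) (mxdot_row (P - _)) mulr_sumr.
  by apply: ler_sum => i _; rewrite row_mul.
have pyX := pythagoras X symP PP.
have pyQ := pythagoras Q symP PP.
have pyP : mxdot P P =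
    mxdot (P *m Q) (P *m Q) + mxdot (P - P *m Q) (P - P *m Q).
  (* Here [Q] multiplies on the right, so [pythagoras] is applied to transposes. *)
  rewrite -(mxdot_trmx P) -(mxdot_trmx (P *m Q)) -(mxdot_trmx (P - _)).
  by rewrite linearB/= trmx_mul symQ; exact: pythagoras.
have pyZ := pythagoras (Z - (X + F)) symP PP.
have pyY := pythagoras (X + F) symP PP.
rewrite !mulmxBl !mul1mx in leX'.
rewrite (mxdot_proj symQ QQ) trQ in pyQ; rewrite (mxdot_proj symP PP) in pyP.
have ZY : Z - (X + F) - P *m (Z - (X + F)) = - (X + F - P *m (X + F)).
  by rewrite mulmxBr PZ; apply/matrixP => i j; rewrite !mxE; ring.
rewrite ZY mxdotNl mxdotNr opprK in pyZ.
have PYE : mxdot (P *m (X + F)) (P *m (X + F)) =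
    mxdot (P *m X) (P *m X) + mxdot (P *m F) (P *m F).
  by rewrite mulmxDr !(mxdotDl, mxdotDr) (mxdotC (P *m F)) PXF0 addr0 add0r.
have YE : mxdot (X + F) (X + F) = mxdot X X + mxdot F F.
  by rewrite !(mxdotDl, mxdotDr) (mxdotC F X) XF0 addr0 add0r.
(* Dropping this term leaves [|X + F|^2 - |P (X + F)|^2] as a lower bound, so it remains to show
   [|P F|^2 <= |X - P X|^2]. The two sides are compared with [s (tr P - |P Q|^2)] and
   [s (r - |P Q|^2)]. *)
have := mxdot_ge0 (P *m (Z - (X + F))).
have trPs : s * \tr P <= s * r%:R by rewrite ler_wpM2l.
have E1 : s * mxdot (Q - P *m Q) (Q - P *m Q) =
  s * r%:R - s * mxdot (P *m Q) (P *m Q) by rewrite pyQ; ring.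
have E2 : s * mxdot (P - P *m Q) (P - P *m Q) =
  s * \tr P - s * mxdot (P *m Q) (P *m Q) by rewrite pyP; ring.
rewrite E1 in leX'; rewrite E2 in leF'.
lra.
Qed.

End OrthogonalProjections.

(** * Critical points with nonnegative Hessian form *)

Section CriticalPoints.
Variables (R : realType) (n m r : nat) (Y : 'M[R]_(n, m)).
Variables (U : 'M[R]_(n, r)) (V : 'M[R]_(m, r)).
Let E := residual Y (U, V).
Hypothesis UVcrit : critical_point (objective Y) (U, V).
Hypothesis hessian_ge0 : forall q, 0 <= hessian_form Y (U, V) q q.

Let gradient0 q : mxdot E (cross (U, V) q) = 0.
Proof.
have /eqP := gradient_form_critical q UVcrit.
by rewrite mulf_eq0 pnatr_eq0 => /eqP.
Qed.

(** The gradient tested along [(E V, 0)] is a multiple of [|E V|^2]; the direction [(0, E^T U)]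
    serves [residual_mulU] in the same way. *)
Let residual_mulV : E *m V = 0.
Proof.
apply: mxdot_eq0; rewrite mxdot_mulmxl -[RHS](gradient0 (E *m V, 0)).
by rewrite /cross/= trmx0 mulmx0 add0r.
Qed.

Let residual_mulU : E^T *m U = 0.
Proof.
apply: mxdot_eq0; rewrite mxdot_mulmxl -mxdot_trmx.
rewrite trmxK -[RHS](gradient0 (0, E^T *m U)).
by rewrite /cross/= mul0mx addr0 (trmx_mul _ U^T) trmxK.
Qed.

(** The right side is half the Hessian form along [(a^T p, b^T q)]; pairing [E] with the rank one
    matrix [a^T (p q^T) b] splits into two scalar products. *)
Let hessian_ge0_rank1 (a : 'rV[R]_n) (b : 'rV[R]_m) (p q : 'rV[R]_r) :
  0 <= mxdot (a^T *m (p *m V^T) + U *m q^T *m b)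
             (a^T *m (p *m V^T) + U *m q^T *m b)
       + 2 * (mxdot p q * mxdot (a *m E) b).
Proof.
have := hessian_ge0 (a^T *m p, b^T *m q).
rewrite /hessian_form pmulr_rge0// /cross/= -/E !trmx_mul trmxK.
rewrite [X in mxdot X X]addrC !mulmxA; congr (_ <= _ + _).
rewrite mxdotDr -mulr2n mulr_natl.
rewrite -(mulmxA a^T) mxdot_rV_mul mul_mx_scalar -scalemxAl mxdotZr.
by congr (_ * _ *+ 2); rewrite mxdotC mxdot_mulmxr trmxK mxdotC.
Qed.

Lemma rank_deficient_residual : (\rank U < r)%N -> E = 0.
Proof.
move=> rU; have [w wK w0] : exists2 w : 'rV[R]_r, w *m U^T = 0 & w != 0.
  have /rowV0Pn[w /sub_kermxP wU w0] : kermx U^T != 0.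
    by rewrite kermx_eq0 /row_free mxrank_tr ltn_eqF.
  by exists w.
have ww : 0 < mxdot w w.
  rewrite lt_neqAle mxdot_ge0 andbT eq_sym.
  by apply: contra_neq w0; exact: mxdot_eq0.
apply/row_matrixP => i; rewrite row0 rowE.
set a := delta_mx 0 i; apply: mxdot_eq0.
pose c := mxdot (a^T *m (w *m V^T)) (a^T *m (w *m V^T)).
set d := mxdot _ _; have d_ge0 : 0 <= d by exact: mxdot_ge0.
apply/eqP; rewrite eq_le d_ge0 andbT leNgt; apply/negP => d_gt0.
(* As [U w^T = 0], the form along this direction is [c - 2 t |w|^2 d], affine in [t]; this [t] makes
   it exactly -1. *)
pose t := (c + 1) / (2 * (mxdot w w * d)).
have := hessian_ge0_rank1 a (- t *: (a *m E)) w w.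
rewrite (_ : U *m w^T = 0); last first.
  by apply: trmx_inj; rewrite trmx_mul trmxK wK trmx0.
rewrite mul0mx addr0 -/c mxdotZr -/d.
rewrite (_ : _ + _ = -1) ?oppr_ge0 ?ler10//.
by rewrite /t; field; rewrite !gt_eqF.
Qed.

(** [best_approximation] applies with [F = - E], [Q] the projection onto the columns of [U], and [P]
    one whose range contains the columns of the competitor [Z]. *)
Lemma full_rank_global_minimum :
  (0 < n)%N -> \rank U = r -> global_minimum (objective Y) (U, V).
Proof.
move=> n0 rU [U' V']; rewrite !objectiveE -/E /residual/=.
set X := U *m V^T; set Z := U' *m V'^T.
(* Minimising the form of [- E E^T] maximises [|a E|^2] over unit [a]. *)
have [a a1 amax] := rayleigh_min (- (E *m E^T)) n0.
pose s := mxdot (a *m E) (a *m E).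
have sE : mxdot (a *m - (E *m E^T)) a = - s.
  by rewrite mulmxN mxdotNl mulmxA mxdot_mulmxl trmxK.
have leF (x : 'rV[R]_n) : mxdot (x *m - E) (x *m - E) <= s * mxdot x x.
  have := amax x; rewrite sE mulNr mulmxN mxdotNl mulmxA mxdot_mulmxl trmxK.
  by rewrite lerN2 mulmxN mxdotNl mxdotNr opprK.
have QQ := colproj_idem rU; set Q := colproj U in QQ.
have leX (x : 'rV[R]_n) :
      s * mxdot (x *m Q) (x *m Q) <= mxdot (x *m X) (x *m X).
  (* The inverse Gram matrix in [q] gives [q U^T = x Q] and [p q^T = |x Q|^2]. With [b = - a E] the
     mixed term vanishes because [E V = 0], and the form becomes [|x X|^2 - s |x Q|^2]. *)
  pose p := x *m U; pose q := x *m U *m invmx (U^T *m U).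
  have pV : p *m V^T = x *m X by rewrite /p /X mulmxA.
  have qU : q *m U^T = x *m Q by rewrite /q /Q /colproj !mulmxA.
  have pq : mxdot p q = mxdot (x *m Q) (x *m Q).
    rewrite [RHS]mxdot_mulmxl colproj_tr -mulmxA QQ -qU.
    by rewrite [RHS]mxdotC [RHS]mxdot_mulmxl trmxK mxdotC.
  have y0 : mxdot (x *m X) (a *m E) = 0.
    by rewrite -pV mxdot_mulmxl trmxK -mulmxA residual_mulV mulmx0 mxdot0r.
  have := hessian_ge0_rank1 a (- (a *m E)) p q; rewrite pV pq mxdotNr -/s.
  rewrite (_ : U *m q^T = (x *m Q)^T); last by rewrite -qU [RHS]trmx_mul trmxK.
  rewrite mulmxN !(mxdotDl, mxdotDr) !(mxdotNl, mxdotNr) !mxdot_outer.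
  rewrite a1 y0 (mxdotC (a *m E)) y0 -/s; lra.
have EY : (X - E) = Y by rewrite /E /residual/= subKr.
rewrite -[mxdot E E]opprK -mxdotNl -mxdotNr -[in X in _ <= X]EY.
(* [U'] may be rank deficient, so the projection is built on a basis of its column space; its trace
   [\rank U'] is at most [r]. *)
have rC : \rank (col_base U') = \rank U' by apply/eqP; exact: col_base_full.
apply: (@best_approximation _ _ _ r s _ _ _ (colproj (col_base U')) Q).
- exact: mxdot_ge0.
- exact: colproj_tr.
- exact: QQ.
- exact: mxtrace_colproj.
- exact: colproj_tr.
- exact: colproj_idem.
- by rewrite mxtrace_colproj// ler_nat rank_leq_col.
- rewrite mulmxN /Q /colproj -(mulmxA _ U^T) -[U^T *m E]trmxK.
  by rewrite trmx_mul trmxK residual_mulU trmx0 mulmx0 oppr0.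
- rewrite linearN/= mulmxN /X -mulmxA -trmx_mul residual_mulV.
  by rewrite trmx0 mulmx0 oppr0.
- rewrite /Z mulmxA; congr (_ *m _).
  by rewrite -[in RHS](mulmx_base U') -[X in _ *m X = _]mulmx_base
    mulmxA colproj_mul.
- exact: leX.
- exact: leF.
Qed.

End CriticalPoints.

Theorem theorem8 (R : realType) (n m r : nat)
    (hn : (0 < n)%N) (hm : (0 < m)%N) (hr : (0 < r)%N) (hrnm : (r <= minn n m)%N)
    (Y : 'M[R]_(n, m)) (U : 'M[R]_(n, r)) (V : 'M[R]_(m, r)) :
  critical_point (objective Y) (U, V) ->
  global_minimum (objective Y) (U, V) \/ strict_saddle (objective Y) (U, V).
Proof.
move=> UVcrit.
have [[q q_lt0]|/forallNP no_neg] :=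
    pselect (exists q, hessian_form Y (U, V) q q < 0).
  by right; exact: strict_saddle_hessian q_lt0.
have hess q : 0 <= hessian_form Y (U, V) q q.
  by rewrite leNgt; apply/negP; exact: no_neg.
(* If [U] is rank deficient the residual is zero, so the objective attains its lower bound 0;
   otherwise [U] has full column rank. *)
left; have [rU|] := ltnP (\rank U) r.
  move=> q; rewrite !objectiveE (rank_deficient_residual hess rU).
  by rewrite mxdot0l mxdot_ge0.
move=> rU; apply: full_rank_global_minimum => //.
by apply/eqP; rewrite eqn_leq rank_leq_col.
Qed.
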